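(* A real square matrix $\mathcal N$ is similar to a Laplacian matrix $\mathcal L$ associated with an undirected connected (weighted) graph if and only if $\mathcal N$ is diagonalizable and has exactly one zero eigenvalue while all its other eigenvalues are real and positive.
   Context: The Laplacian matrix of an undirected weighted graph on $n$ nodes with edge weights $w_{ij}=w_{ji}\ge0$ ($i\ne j$; an edge $\{i,j\}$ is present iff $w_{ij}>0$) is the real $n\times n$ matrix $\mathcal L$ with $\mathcal L_{ij}=-w_{ij}$ for $i\neq j$ and $\mathcal L_{ii}=\sum_{j\ne i}w_{ij}$. Eigenvalues are counted with multiplicity. *)

(* Defs.v *)
From mathcomp Require Import all_boot all_order all_algebra.
From mathcomp Require Import reals.
From mathcomp Require Import complex.

Set Implicit Arguments.
Unset Strict Implicit.
Unset Printing Implicit Defensive.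
Import Order.TTheory GRing.Theory Num.Theory.
Local Open Scope ring_scope.

(* The diagonal values [weight i i] are junk: graphs have no self-loops, and
   neither [edge] nor [laplacian] reads them. *)
Record wgraph (R : realType) (n : nat) := WGraph {
  weight : 'I_n -> 'I_n -> R;
  weight_sym : forall i j, i != j -> weight i j = weight j i;
  weight_ge0 : forall i j, i != j -> 0 <= weight i j
}.

Definition edge (R : realType) (n : nat) (G : wgraph R n) : rel 'I_n :=
  fun i j => (i != j) && (0 < weight G i j).

Definition connected_wgraph (R : realType) (n : nat) (G : wgraph R n) : Prop :=
  forall i j : 'I_n, connect (edge G) i j.

Definition laplacian (R : realType) (n : nat) (G : wgraph R n) : 'M[R]_n :=
  \matrix_(i, j)
    if i == j then \sum_(k | k != i) weight G i k else - weight G i j.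

(* Spectral notions for a real matrix are taken over the complex numbers, so
   that its eigenvalues are not real by fiat. *)
Definition complexify (R : realType) (n : nat) (A : 'M[R]_n) : 'M[R[i]]_n :=
  map_mx (real_complex R) A.

Definition alg_mult (R : realType) (n : nat) (A : 'M[R]_n) (z : R[i]) : nat :=
  mup z (char_poly (complexify A)).

(* Main.v *)
Require Import Defs.
From mathcomp Require Import all_boot all_order all_algebra.
From mathcomp Require Import reals.
From mathcomp Require Import complex.
From mathcomp Require Import perm ring.

Set Implicit Arguments.
Unset Strict Implicit.
Unset Printing Implicit Defensive.
Import Order.TTheory GRing.Theory Num.Theory.
Local Open Scope ring_scope.

(** A Laplacian is real symmetric, hence diagonalizable, and its quadratic form
    is the energy, the sum of w_ij |v_i - v_j|^2 over the edges
    ([laplacian_energy]). The energy is nonnegative, so no eigenvalue is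
    negative; it vanishes only on vectors that are constant along edges, so
    for a connected graph the kernel is the line of constant vectors. All three
    spectral properties are invariant under similarity.

    Conversely, a matrix that is diagonalizable over the complex numbers with
    real eigenvalues is already diagonalizable over the reals
    ([diagonalizable_real]), so it is similar to a diagonal matrix with
    nonincreasing entries e_0 >= ... >= e_m = 0, of which only the last is
    zero. It remains to find a connected weighted graph with this spectrum. Its
    Laplacian is built from the Helmert matrix, whose rows, for k < m,
<<
      (1, ..., 1, -(k+1), 0, ..., 0)      (k+1 ones)
>>
    and (1, ..., 1) for k = m, are orthogonal. The matrix L with these rows as
    eigenvectors for e_0, ..., e_m is symmetric and kills the constants. For
    i < j its entry L_ij is the sum over k of e_k h_kj / |h_k|^2, because
    h_ki = 1 whenever h_kj <> 0. In column j the only negative h_kj stands in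
    row j - 1, and the positive ones below it, so monotonicity of e bounds each
    term by e_(j-1) h_kj / |h_k|^2; these bounds add up to zero by
    orthogonality, and the bound is strict in the last row, where e vanishes.
    So all off-diagonal entries of L are negative, and L is the Laplacian of a
    complete graph with positive weights. *)

(** * Diagonal matrices, similarity and multiplicities *)

Lemma char_poly_similar (F : fieldType) n (P A B : 'M[F]_n) :
  P \in unitmx -> P *m A = B *m P -> char_poly A = char_poly B.
Proof.
move=> Pu PA; pose Q := map_mx polyC P.
have QAB : Q *m char_poly_mx A = char_poly_mx B *m Q.
  by rewrite /char_poly_mx mulmxBr mulmxBl -!map_mxM PA scalar_mxC.
have detQ0 : \det Q != 0.
  by rewrite det_map_mx polyC_eq0 -unitfE -unitmxE.
by apply: (mulfI detQ0); rewrite -det_mulmx QAB det_mulmx mulrC.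
Qed.

Lemma mup_prod_XsubC (F : fieldType) n (d : 'I_n -> F) z :
  mup z (\prod_i ('X - (d i)%:P)) = #|[pred i | d i == z]|.
Proof.
rewrite -sum1_card [in RHS]big_mkcond /=.
pose K (p : {poly F}) (k : nat) := p != 0 /\ mup z p = k.
suff : K (\prod_i ('X - (d i)%:P))
    (\sum_i (if i \in [pred i | d i == z] then 1 else 0))%N.
  by case.
apply: (big_rec2 K) => [|i k p _ [p0 mp]].
  by rewrite /K oner_eq0 mupNroot // rootC oner_eq0.
rewrite /K mulf_eq0 negb_or p0 polyXsubC_eq0; split=> //.
by rewrite mupM ?polyXsubC_eq0 // mp -['X - _]expr1 mup_XsubCX.
Qed.

Lemma mup_char_poly_diag (F : fieldType) n (P A : 'M[F]_n) (d : 'rV[F]_n) z :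
  P \in unitmx -> P *m A = diag_mx d *m P ->
  mup z (char_poly A) = #|[pred i | d 0 i == z]|.
Proof.
move=> Pu PA; rewrite (char_poly_similar Pu PA) char_poly_trig; last first.
  exact: diag_mx_is_trig.
under eq_bigr do rewrite mxE eqxx mulr1n.
exact: (mup_prod_XsubC (d 0)).
Qed.

Lemma row_eigenvector (F : fieldType) n (P A : 'M[F]_n) (d : 'rV[F]_n) i :
  P *m A = diag_mx d *m P -> row i P *m A = d 0 i *: row i P.
Proof.
by move=> PA; rewrite -row_mul PA row_mul row_diag_mx -scalemxAl -rowE.
Qed.

Lemma row_unitmx_neq0 (F : fieldType) n (P : 'M[F]_n) i :
  P \in unitmx -> row i P != 0.
Proof.
move=> Pu; rewrite rowE; apply/negP => /eqP/(congr1 (mulmx^~ (invmx P))).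
rewrite mulmxK // mul0mx => /matrixP/(_ 0 i)/eqP.
by rewrite !mxE !eqxx oner_eq0.
Qed.

Lemma eigenvalue_diag (F : fieldType) n (P A : 'M[F]_n) (d : 'rV[F]_n) i :
  P \in unitmx -> P *m A = diag_mx d *m P -> eigenvalue A (d 0 i).
Proof.
move=> Pu PA; apply/eigenvalueP; exists (row i P); last exact: row_unitmx_neq0.
exact: row_eigenvector.
Qed.

Lemma diagonalizableE (F : fieldType) n (A : 'M[F]_n) :
  diagonalizable A <->
  exists2 P, P \in unitmx & exists d, P *m A = diag_mx d *m P.
Proof.
split=> [[P Pu /similar_diagPex[d /(similarP Pu) PA]]|[P Pu [d PA]]].
  by exists P => //; exists d.
by exists P => //; apply/similar_diagPex; exists d; apply/similarP.
Qed.

(** Diagonalizability is read off the minimal polynomial, which does not change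
    under field extension: over the complex numbers it is a product of distinct
    linear factors, and their roots are eigenvalues, hence real. *)
Lemma diagonalizable_real (R : realType) n (A : 'M[R]_n) :
  diagonalizable (complexify A) ->
  (forall z, eigenvalue (complexify A) z -> complex.Im z = 0) ->
  diagonalizable A.
Proof.
case: n A => [|n] A [P Pu PA] Areal.
  by exists 1%:M; rewrite ?unitmx1 //; apply/is_diag_mxP => -[].
have minA := similar_diag_mxminpoly Pu PA.
set rs := undup _ in minA.
have rsR z : z \in rs -> real_complex R (complex.Re z) = z.
  move=> zrs; have : eigenvalue (complexify A) z.
    by rewrite eigenvalue_root_min minA root_prod_XsubC.
  by move/Areal; case: z {zrs} => a b /= ->.
apply/diagonalizableP; exists (map (@complex.Re R) rs).
  rewrite map_inj_in_uniq ?undup_uniq // => x y /rsR {2}<- /rsR {2}<-.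
  by rewrite /= => ->.
rewrite -(dvdp_map (real_complex R)) -mxminpoly_map.
rewrite big_map map_prod_XsubC [X in X %| _]minA.
rewrite [X in _ %| X](eq_big_seq (fun z => 'X - z%:P)) ?dvdpp // => z.
by move=> zrs; rewrite /= -[in RHS](rsR z zrs).
Qed.

(** * Spectrum of the Laplacian of a connected graph *)

Section LaplacianSpectrum.
Variables (R : realType) (n : nat) (G : wgraph R n).
Local Notation C := R[i].
Local Notation L := (complexify (laplacian G)).
Local Notation w i j := (real_complex R (weight G i j)).

Lemma laplacian_sym : (laplacian G)^T = laplacian G.
Proof.
apply/matrixP => i j; rewrite !mxE eq_sym; case: eqVneq => [->//|ij].
by rewrite weight_sym // eq_sym.
Qed.

Lemma mul_laplacian (v : 'rV[C]_n) j :
  (v *m L) 0 j = \sum_(i | i != j) w j i * (v 0 j - v 0 i).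
Proof.
rewrite mxE (bigD1 j) //= !mxE eqxx rmorph_sum mulr_sumr -big_split /=.
apply: eq_bigr => i ij; rewrite !mxE (negbTE ij) rmorphN /=.
by rewrite (weight_sym G ij) mulrBr mulrN !(mulrC (v _ _)).
Qed.

(** The sum runs over ordered pairs, so each edge counts twice. The summand
    w_ij (v_j - v_i) v_j^* of the quadratic form becomes w_ij |v_j - v_i|^2
    when it is added to its copy with i and j exchanged. *)
Lemma laplacian_energy (v : 'rV[C]_n) :
  \sum_j (v *m L) 0 j * Num.conj (v 0 j) *+ 2 =
  \sum_j \sum_(i | i != j) w j i * `|v 0 j - v 0 i| ^+ 2.
Proof.
pose f j i := w j i * (v 0 j - v 0 i) * Num.conj (v 0 j).
have -> : \sum_j (v *m L) 0 j * Num.conj (v 0 j) *+ 2 =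
    \sum_j \sum_(i | i != j) f j i + \sum_j \sum_(i | i != j) f i j.
  rewrite [X in _ = _ + X](exchange_big_dep predT) //= -big_split /=.
  apply: eq_bigr => j _; rewrite mul_laplacian mulr_suml mulr2n.
  by congr (_ + _); apply: eq_bigl => i; rewrite eq_sym.
rewrite -big_split /=; apply: eq_bigr => j _.
rewrite -big_split /=; apply: eq_bigr => i ij.
rewrite /f (weight_sym G ij) normCK rmorphB /= -!mulrA -mulrDr; congr (_ * _).
by rewrite -(opprB (v 0 j) (v 0 i)) mulNr -mulrBr.
Qed.

Lemma laplacian_diagonalizable : diagonalizable L.
Proof.
suff /orthomx_spectralP LE : L \is normalmx.
  apply/diagonalizableE; exists (spectralmx L); first exact: spectral_unit.
  exists (spectral_diag L); rewrite {2}LE.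
  by rewrite !mulmxA mulmxV ?mul1mx ?spectral_unit.
apply: symmetric_normalmx.
  by apply/is_hermitianmxP; rewrite scale1r map_mx_id // map_trmx laplacian_sym.
apply/mxOverP => i j; rewrite mxE; exact/complex_realP/ex_intro.
Qed.

Lemma energy_ge0 (v : 'rV[C]_n) j i : i != j ->
  0 <= w j i * `|v 0 j - v 0 i| ^+ 2.
Proof.
move=> ij; rewrite mulr_ge0 ?exprn_ge0 // ler0c weight_ge0 //.
by rewrite eq_sym.
Qed.

(** On an eigenvector for z the energy is 2 z |v|^2. The order of the complex
    numbers makes 0 <= z say that z is real as well. *)
Lemma laplacian_eigenvalue_ge0 z : eigenvalue L z -> 0 <= z.
Proof.
case/eigenvalueP => v vL v0.
have := laplacian_energy v; rewrite vL.
have -> : \sum_j (z *: v) 0 j * Num.conj (v 0 j) *+ 2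
    = z * ((\sum_j `|v 0 j| ^+ 2) *+ 2).
  rewrite -!sumrMnl mulr_sumr; apply: eq_bigr => j _.
  by rewrite mxE normCK -mulrA mulrnAr.
have pos : 0 < (\sum_j `|v 0 j| ^+ 2) *+ 2.
  have [j vj] : exists j, v 0 j != 0 by apply/rV0Pn.
  rewrite pmulrn_lgt0 // (bigD1 j) //= ltr_wpDr ?exprn_gt0 ?normr_gt0 //.
  by apply: sumr_ge0 => i _; rewrite exprn_ge0.
move=> E; rewrite -(pmulr_lge0 z pos) E.
by apply: sumr_ge0 => j _; apply: sumr_ge0 => i; apply: energy_ge0.
Qed.

(** The energy of a kernel vector is zero, hence so is each of its terms. *)
Lemma laplacian_kernel (v : 'rV[C]_n) : connected_wgraph G ->
  v *m L = 0 -> forall i j, v 0 i = v 0 j.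
Proof.
move=> Gc vL.
have := laplacian_energy v; rewrite vL.
rewrite big1 => [|j _]; last by rewrite mxE mul0r mul0rn.
move/esym => E.
have edgeE i j : edge G i j -> v 0 i = v 0 j.
  case/andP => ij wij.
  have inner k : 0 <= \sum_(l | l != k) w k l * `|v 0 k - v 0 l| ^+ 2.
    by apply: sumr_ge0 => l; apply: energy_ge0.
  have Ei : \sum_(l | l != i) w i l * `|v 0 i - v 0 l| ^+ 2 = 0.
    by apply: (psumr_eq0P _ E) => // k _; apply: inner.
  have /eqP : w i j * `|v 0 i - v 0 j| ^+ 2 = 0.
    by apply: (psumr_eq0P _ Ei); [exact: energy_ge0 | rewrite eq_sym].
  rewrite mulf_eq0 expf_eq0 normr_eq0 subr_eq0 /=.
  by case/orP => /eqP // /complexI w0; rewrite w0 ltxx in wij.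
move=> i j; case/connectP: (Gc i j) => p.
elim: p i => [|k p IHp] i /=; first by move=> _ ->.
by case/andP => /edgeE -> /IHp.
Qed.

Lemma laplacian_const : const_mx 1 *m L = 0 :> 'rV[C]_n.
Proof.
apply/rowP => j; rewrite mul_laplacian big1 ?mxE // => i _.
by rewrite !mxE subrr mulr0.
Qed.

(** For a diagonalizable matrix the multiplicity of 0 counts the rows of the
    diagonalizing basis that lie in the kernel. Two distinct such rows would be
    constant, hence proportional; and there is at least one, since the constants
    are in the kernel. *)
Lemma laplacian_alg_mult0 : (0 < n)%N -> connected_wgraph G ->
  alg_mult (laplacian G) 0 = 1%N.
Proof.
move=> n_gt0 Gc; have /diagonalizableE[P Pu [d PL]] := laplacian_diagonalizable.
apply/eqP; rewrite eqn_leq; apply/andP; split.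
  rewrite /alg_mult (mup_char_poly_diag _ Pu PL).
  apply/card_le1_eqP => i j; rewrite !inE => /eqP di /eqP dj.
  have row_const k : d 0 k = 0 -> exists2 a, a != 0 & row k P = const_mx a.
    move=> dk; have := row_eigenvector k PL; rewrite dk scale0r => kerk.
    pose o := Ordinal n_gt0; have cst := laplacian_kernel Gc kerk.
    have Pk : row k P = const_mx (row k P 0 o).
      by apply/rowP => l; rewrite [RHS]mxE; apply: cst.
    exists (row k P 0 o) => //; apply: contraNneq (row_unitmx_neq0 k Pu) => a0.
    by rewrite Pk a0; apply/eqP/matrixP => ? ?; rewrite !mxE.
  have [a a0 Pi] := row_const i di; have [b b0 Pj] := row_const j dj.
  have : (b *: delta_mx 0 i - a *: delta_mx 0 j : 'rV_n) *m P = 0.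
    rewrite mulmxBl -!scalemxAl -!rowE Pi Pj; apply/rowP => l.
    by rewrite !mxE mulrC subrr.
  move/(congr1 (mulmx^~ (invmx P))); rewrite mulmxK // mul0mx.
  move/rowP/(_ i); rewrite !mxE !eqxx /=; case: eqVneq => //= _.
  by rewrite mulr1 mulr0 subr0 => /eqP; rewrite (negbTE b0).
rewrite /alg_mult -XsubC_dvd ?monic_neq0 ?char_poly_monic // dvdp_XsubCl.
rewrite -eigenvalue_root_char; apply/eigenvalueP; exists (const_mx 1).
  by rewrite laplacian_const scale0r.
apply/rV0Pn; exists (Ordinal n_gt0).
by rewrite mxE oner_eq0.
Qed.

End LaplacianSpectrum.
(** * A Laplacian with prescribed spectrum *)

Section Helmert.
Variables (R : realType) (m : nat).
Local Notation n := m.+1.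

(** The rows are left unnormalized. No column has index [m.+1], so the last row,
    of index [m], is constant. *)
Definition helmert : 'M[R]_n :=
  \matrix_(k, j)
    if (j <= k)%N then 1 else if j == k.+1 :> nat then - k.+1%:R else 0.

Definition helmert_norm2 : 'rV[R]_n := \row_k \sum_j helmert k j ^+ 2.

Lemma helmert_sum (k : 'I_n) : k != ord_max -> \sum_j helmert k j = 0.
Proof.
move=> kmax; have k_lt : (k.+1 < n)%N.
  by rewrite ltnS ltn_neqAle kmax -ltnS ltn_ord.
pose f j : R := if (j <= k)%N then 1 else if j == k.+1 then - k.+1%:R else 0.
transitivity (\sum_(0 <= j < n) f j).
  by rewrite big_mkord; apply: eq_bigr => j _; rewrite mxE.
rewrite (big_cat_nat (n := k.+1)) //= ?(ltnW k_lt) // (big_ltn k_lt).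
have -> : \sum_(0 <= j < k.+1) f j = k.+1%:R.
  rewrite big_nat (eq_bigr (fun=> 1)) => [|j]; last by rewrite /f ltnS /= => ->.
  by rewrite -big_nat big_const_nat subn0 iter_addr_0.
have -> : \sum_(k.+2 <= j < n) f j = 0.
  rewrite big_nat big1 // => j /andP[kj _].
  by rewrite /f leqNgt (ltnW kj) /= gtn_eqF.
by rewrite /f ltnn eqxx addr0 subrr.
Qed.

Lemma helmert_norm2_gt0 k : 0 < helmert_norm2 0 k.
Proof.
rewrite mxE (bigD1 k) //= ltr_wpDr //.
  by apply: sumr_ge0 => j _; rewrite sqr_ge0.
by rewrite mxE leqnn expr1n ltr01.
Qed.

Lemma helmert_mul_lt (k l j : 'I_n) : (k < l)%N ->
  helmert k j * helmert l j = helmert k j.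
Proof.
move=> kl; rewrite !mxE; case: leqP => kj.
  by rewrite (leq_trans kj (ltnW kl)) mulr1.
case: eqP => [jk|_]; last by rewrite mul0r.
by rewrite {1}jk kl mulr1.
Qed.

Lemma helmert_col_mul_lt (k i j : 'I_n) : (i < j)%N ->
  helmert k i * helmert k j = helmert k j.
Proof.
move=> ij; rewrite !mxE; case: leqP => ik; first by rewrite mul1r.
have kj : (k.+1 < j)%N by apply: leq_ltn_trans ij.
by rewrite [(j <= k)%N]leqNgt (ltnW kj) (gtn_eqF kj) mulr0.
Qed.

(** For k < l the row l is constant on the support of the row k, whose entries
    add up to zero. *)
Lemma helmert_orthogonal : helmert *m helmert^T = diag_mx helmert_norm2.
Proof.
have lt0 (k l : 'I_n) : (k < l)%N -> \sum_j helmert k j * helmert l j = 0.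
  move=> kl; under eq_bigr do rewrite helmert_mul_lt //.
  apply: helmert_sum; apply: contraTneq kl => ->.
  by rewrite -leqNgt -ltnS ltn_ord.
apply/matrixP => k l; rewrite [LHS]mxE [RHS]mxE.
under eq_bigr do rewrite [_^T _ _]mxE.
case: (ltngtP k l) => [kl|lk|/val_inj <-].
- by rewrite lt0 // -val_eqE (ltn_eqF kl).
- by under eq_bigr do rewrite mulrC; rewrite lt0 // -val_eqE (gtn_eqF lk).
- by rewrite eqxx mulr1n mxE.
Qed.

Definition helmert_inv : 'M[R]_n :=
  helmert^T *m diag_mx (\row_k (helmert_norm2 0 k)^-1).

Lemma helmert_invE i k : helmert_inv i k = helmert k i / helmert_norm2 0 k.
Proof.
by rewrite /helmert_inv mul_mx_diag [LHS]mxE [helmert^T _ _]mxE [_ 0 k]mxE.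
Qed.

Lemma helmertV : helmert *m helmert_inv = 1%:M.
Proof.
rewrite mulmxA helmert_orthogonal mulmx_diag -diag_const_mx.
congr diag_mx; apply/rowP => k; rewrite [LHS]mxE [X in _ * X]mxE [RHS]mxE.
by rewrite divff // gt_eqF ?helmert_norm2_gt0.
Qed.

Lemma helmert_unit : helmert \in unitmx.
Proof. by case: (mulmx1_unit helmertV). Qed.

Variable e : 'rV[R]_n.

(** The matrix with the Helmert rows as eigenvectors for the eigenvalues e;
    symmetric, since the Helmert rows are orthogonal. *)
Definition spectral_laplacian : 'M[R]_n := helmert_inv *m diag_mx e *m helmert.

Lemma helmert_similar :
  helmert *m spectral_laplacian = diag_mx e *m helmert.
Proof. by rewrite /spectral_laplacian -mulmxA mulmxA helmertV mul1mx. Qed.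

Lemma spectral_laplacianE i j : spectral_laplacian i j =
  \sum_k helmert k i * helmert k j / helmert_norm2 0 k * e 0 k.
Proof.
rewrite mxE; apply: eq_bigr => k _.
by rewrite mul_mx_diag [X in X * _]mxE helmert_invE; ring.
Qed.

Lemma spectral_laplacian_sym i j :
  spectral_laplacian i j = spectral_laplacian j i.
Proof.
rewrite !spectral_laplacianE; apply: eq_bigr => k _.
by rewrite (mulrC (helmert k i)).
Qed.

(** Every Helmert row but the last is orthogonal to the constants, and the
    eigenvalue of the last row is zero. *)
Lemma spectral_laplacian_row_sum i : e 0 ord_max = 0 ->
  \sum_j spectral_laplacian i j = 0.
Proof.
move=> e_max.
have sumE (A : 'M[R]_n) k : \sum_j A k j = (A *m const_mx 1 : 'cV_n) k 0.
  by rewrite mxE; apply: eq_bigr => j _; rewrite mxE mulr1.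
rewrite sumE /spectral_laplacian -!mulmxA.
suff -> : diag_mx e *m (helmert *m const_mx 1) = 0 :> 'cV_n.
  by rewrite !mulmx0 mxE.
apply/colP => k; rewrite mul_diag_mx [LHS]mxE [RHS]mxE -sumE.
have [->|kmax] := eqVneq k ord_max; first by rewrite e_max mul0r.
by rewrite helmert_sum // mulr0.
Qed.

(** For i < j, each term of the entry (i, j) is at most the term in which the
    eigenvalue is replaced by that of row j - 1: the Helmert entries of column j
    are zero above that row and positive below it, where the eigenvalues are
    at most as large. With a single eigenvalue the sum vanishes by
    orthogonality. *)
Lemma spectral_laplacian_lt0 i j :
  (forall k l : 'I_n, (k <= l)%N -> e 0 l <= e 0 k) ->
  e 0 ord_max = 0 -> (forall k, k != ord_max -> 0 < e 0 k) ->
  i != j -> spectral_laplacian i j < 0.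
Proof.
move=> e_dec e_max e_gt0.
wlog ij : i j / (i < j)%N => [hw|_].
  rewrite neq_ltn => /orP[] ij; first by apply: hw => //; rewrite neq_ltn ij.
  by rewrite spectral_laplacian_sym; apply: hw => //; rewrite neq_ltn ij.
have p_lt : (j.-1 < n)%N by rewrite (leq_ltn_trans (leq_pred j)).
pose p := Ordinal p_lt; pose q k := helmert_norm2 0 k.
have pS : p.+1 = j by rewrite /= prednK // (leq_ltn_trans _ ij).
have pmax : p != ord_max by rewrite -val_eqE /= -eqSS pS ltn_eqF.
(* The entry (j, i) of the identity, as a product of the inverse with the
   Helmert matrix. *)
have sum0 : \sum_k helmert k j / q k = 0.
  have /matrixP/(_ j i) := mulmx1C helmertV.
  rewrite [RHS]mxE -val_eqE (gtn_eqF ij) mxE => E; rewrite -[RHS]E.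
  apply: eq_bigr => k _; rewrite helmert_invE.
  by rewrite -[in LHS](helmert_col_mul_lt k ij); ring.
rewrite spectral_laplacianE.
under eq_bigr do rewrite helmert_col_mul_lt //.
have term k : helmert k j / q k * e 0 k
    <= e 0 p * (helmert k j / q k).
  have qV0 : 0 <= (q k)^-1 by rewrite invr_ge0 ltW ?helmert_norm2_gt0.
  rewrite [e 0 p * _]mulrC !mxE; case: leqP => jk.
    rewrite mul1r ler_wpM2l // e_dec //.
    by rewrite (leq_trans _ jk) // leq_pred.
  case: eqP => [jkS|_]; last by rewrite !mul0r.
  by have -> : k = p by apply: val_inj; rewrite /= jkS.
have sum_p0 : \sum_k e 0 p * (helmert k j / q k) = 0.
  by rewrite -mulr_sumr sum0 mulr0.
(* The strict inequality comes from the last row, where e vanishes. *)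
rewrite -[ltRHS]sum_p0 (bigD1 ord_max) //= [ltRHS](bigD1 ord_max) //=.
apply: ltr_leD; last by apply: ler_sum => k _; apply: term.
rewrite e_max mulr0 mulr_gt0 ?e_gt0 //.
by rewrite divr_gt0 ?helmert_norm2_gt0 // mxE -ltnS ltn_ord.
Qed.

End Helmert.

Lemma exists_laplacian_diag (R : realType) m (e : 'rV[R]_m.+1) :
  (forall i j : 'I_m.+1, (i <= j)%N -> e 0 j <= e 0 i) ->
  e 0 ord_max = 0 -> (forall i, i != ord_max -> 0 < e 0 i) ->
  exists G : wgraph R m.+1, connected_wgraph G /\
    exists2 V, V \in unitmx & V *m laplacian G = diag_mx e *m V.
Proof.
move=> e_dec e_max e_gt0.
have wP i j : i != j -> 0 < - spectral_laplacian e i j.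
  by move=> ij; rewrite oppr_gt0 spectral_laplacian_lt0.
have w_sym i j : i != j ->
    - spectral_laplacian e i j = - spectral_laplacian e j i.
  by rewrite spectral_laplacian_sym.
have w_ge0 i j : i != j -> 0 <= - spectral_laplacian e i j by move/wP/ltW.
exists (WGraph w_sym w_ge0); split=> [i j|].
  have [->|ij] := eqVneq i j; first exact: connect0.
  by apply: connect1; rewrite /edge ij wP.
exists (helmert R m); first exact: helmert_unit.
rewrite -helmert_similar; congr (_ *m _); apply/matrixP => i j.
rewrite mxE /=; case: eqP => [<-|_]; last by rewrite opprK.
rewrite sumrN; apply/eqP; rewrite eq_sym -addr_eq0.
by have := spectral_laplacian_row_sum i e_max; rewrite (bigD1 i) //= => ->.
Qed.

Lemma diag_mx_sort (R : realDomainType) n (d : 'rV[R]_n) :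
  exists (p : {perm 'I_n}) (e : 'rV[R]_n),
    (forall i j : 'I_n, (i <= j)%N -> e 0 j <= e 0 i) /\
    perm_mx p *m diag_mx d = diag_mx e *m perm_mx p.
Proof.
pose s := sort >=%R [seq d 0 i | i <- enum 'I_n].
have [p sE] : exists p : {perm 'I_n},
    s = [tuple tnth (map_tuple (d 0) (ord_tuple n)) (p i) | i < n].
  by apply/tuple_permP; rewrite perm_sort.
exists p, (\row_i d 0 (p i)); split=> [i j ij|].
  have s_nth (k : 'I_n) : d 0 (p k) = nth 0 s k.
    rewrite sE (nth_map k) ?size_enum_ord // nth_ord_enum.
    by rewrite tnth_map tnth_ord_tuple.
  have s_size : size s = n by rewrite size_sort size_map size_enum_ord.
  rewrite !mxE !s_nth.
  apply: (@sorted_leq_nth _ >=%R) => //.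
  - by move=> ? ? ?; apply: ge_trans.
  - exact: ge_refl.
  - by apply: sort_sorted => x y; apply: ge_total.
  - by rewrite inE s_size.
  - by rewrite inE s_size.
rewrite -row_permE; apply/matrixP => i j; rewrite mul_diag_mx !mxE.
by rewrite mulr_natr.
Qed.

(** * The characterization *)

Lemma similar_in_common (F : fieldType) n (P Q A B D : 'M[F]_n) :
  P \in unitmx -> Q \in unitmx -> P *m A = D *m P -> Q *m B = D *m Q ->
  similar_in unitmx A B.
Proof.
move=> Pu Qu PA QB; exists (invmx Q *m P).
  by rewrite unitmx_mul unitmx_inv Qu.
apply/similarP; first by rewrite unitmx_mul unitmx_inv Qu.
by rewrite -mulmxA PA -[D](mulmxK Qu) -QB !mulmxA mulVmx // mul1mx.
Qed.

Lemma complexify_mul (R : realType) n (A B : 'M[R]_n) :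
  complexify (A *m B) = complexify A *m complexify B.
Proof. exact: map_mxM. Qed.

Lemma complexify_unit (R : realType) n (A : 'M[R]_n) :
  (complexify A \in unitmx) = (A \in unitmx).
Proof. exact: map_unitmx. Qed.

Lemma complexify_diag (R : realType) n (d : 'rV[R]_n) :
  complexify (diag_mx d) = diag_mx (map_mx (real_complex R) d).
Proof. exact: map_diag_mx. Qed.

Theorem theorem12 (R : realType) (n : nat) (n_gt0 : (0 < n)%N) (N : 'M[R]_n) :
  (exists G : wgraph R n,
      connected_wgraph G /\ similar_in unitmx N (laplacian G))
  <->
  [/\ diagonalizable (complexify N),
      alg_mult N 0 = 1%N
    & forall z : R[i], eigenvalue (complexify N) z -> z != 0 ->
        complex.Im z = 0 /\ 0 < complex.Re z].
Proof.
split=> [[G [Gc [P Pu /(similarP Pu) PN]]]|[Ndiag N0 Npos]].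
  have cPu : complexify P \in unitmx by rewrite complexify_unit.
  have cPN : complexify P *m complexify N
      = complexify (laplacian G) *m complexify P.
    by rewrite -!complexify_mul PN.
  have chiN := char_poly_similar cPu cPN; split.
  - have [Q Qu [d QL]] := (diagonalizableE _).1 (laplacian_diagonalizable G).
    apply/diagonalizableE; exists (Q *m complexify P).
      by rewrite unitmx_mul Qu.
    by exists d; rewrite [RHS]mulmxA -QL -!mulmxA cPN.
  - by rewrite /alg_mult chiN; apply: laplacian_alg_mult0.
  - move=> z; rewrite eigenvalue_root_char chiN -eigenvalue_root_char.
    move=> /laplacian_eigenvalue_ge0 z_ge0 z_neq0.
    have : 0 < z by rewrite lt_def z_neq0.
    by rewrite ltcE => /andP[/eqP].
case: n n_gt0 N Ndiag N0 Npos => // m _ N Ndiag N0 Npos.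
have Nreal z : eigenvalue (complexify N) z -> complex.Im z = 0.
  by have [->//|z0] := eqVneq z 0; move=> /Npos/(_ z0)[].
have [P Pu [d PN]] := (diagonalizableE _).1 (diagonalizable_real Ndiag Nreal).
have [p [e [e_dec pd]]] := diag_mx_sort d.
pose Q := perm_mx p *m P.
have Qu : Q \in unitmx by rewrite unitmx_mul unitmx_perm.
have QN : Q *m N = diag_mx e *m Q by rewrite -mulmxA PN mulmxA pd mulmxA.
have cQN : complexify Q *m complexify N
    = diag_mx (map_mx (real_complex R) e) *m complexify Q.
  by rewrite -complexify_mul QN complexify_mul complexify_diag.
have cQu : complexify Q \in unitmx by rewrite complexify_unit.
have e_pos i : e 0 i != 0 -> 0 < e 0 i.
  move=> ei; have := eigenvalue_diag i cQu cQN; rewrite mxE => /Npos[] //.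
  by rewrite fmorph_eq0.
have := N0; rewrite /alg_mult (mup_char_poly_diag _ cQu cQN) => zeros.
have /card_le1_eqP zero_uniq := eq_leq zeros.
have [i0 ei0] : exists i, e 0 i = 0.
  have := eq_leq (esym zeros); case/card_gt0P => i.
  by rewrite inE mxE fmorph_eq0 => /eqP; exists i.
have e_ge0 i : 0 <= e 0 i.
  by have [->//|/e_pos/ltW] := eqVneq (e 0 i) 0.
(* The entries are nonnegative and decrease to the last one, so the one zero
   entry is the last. *)
have e_max : e 0 ord_max = 0.
  by apply/eqP; rewrite eq_le e_ge0 andbT -ei0 e_dec // -ltnS ltn_ord.
have e_gt0 i : i != ord_max -> 0 < e 0 i.
  move=> imax; apply: e_pos; apply: contraNneq imax => ei; apply/eqP.
  by apply: zero_uniq; rewrite inE mxE ?ei ?e_max rmorph0.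
have [G [Gc [V Vu VL]]] := exists_laplacian_diag e_dec e_max e_gt0.
by exists G; split=> //; apply: similar_in_common Qu Vu QN VL.
Qed.
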